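(* Let $(X,\varrho)$ be a complete metric space and let $U$ be an m-process on $X$. Then $U$ is pullback asymptotically compact and monotonically dissipative if and only if it possesses a unique backward bounded pullback attractor.
   Context: $P(X)$ is the family of nonempty subsets of $X$, $\mathcal B(X)$ the family of nonempty bounded subsets of $X$, $\mathbb R_d=\{(s,t)\in\mathbb R^2: s\ge t\}$. For a point $y$ and sets $A,B\subset X$: $\mathrm{dist}(y,B)=\inf_{x\in B}\varrho(x,y)$ and $\mathrm{dist}(A,B)=\sup_{y\in A}\mathrm{dist}(y,B)$, with $\inf\emptyset=+\infty$. An m-process on $X$ is a map $U:\mathbb R_d\times X\to P(X)$, $(t,\tau,x)\mapsto U(t,\tau;x)$, such that (i) $U(t,t;x)=\{x\}$ for all $t\in\mathbb R$, $x\in X$; (ii) $U(t,\tau;x)\subset U(t,s;U(s,\tau;x))$ for all $t\ge s\ge\tau$, $x\in X$, where $U(t,s;A)=\bigcup_{y\in A}U(t,s;y)$. No continuity is assumed. A nonautonomous set is a family $\{K(t)\subset X:t\in\mathbb R\}$; it is closed (compact, bounded) if every $K(t)$ is; it is backward bounded if $\bigcup_{t\le\tau}K(t)$ is bounded for every $\tau\in\mathbb R$. It is pullback attracting for $U$ if $\lim_{\tau\to-\infty}\mathrm{dist}(U(t,\tau;B),K(t))=0$ for every $t\in\mathbb R$ and $B\in\mathcal B(X)$. A pullback attractor for $U$ is a nonautonomous set $\{A(t):t\in\mathbb R\}$ that is compact, pullback attracting, and minimal in the class of closed pullback attracting nonautonomous sets (i.e. $A(t)\subset C(t)$ for all $t$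 for every closed pullback attracting $\{C(t)\}$). No invariance is required. $U$ is pullback asymptotically compact if for every $B\in\mathcal B(X)$, $t\in\mathbb R$ and any sequences $\tau_n\to-\infty$, $\xi_n\in U(t,\tau_n;B)$, the sequence $(\xi_n)$ has a subsequence converging in $X$. $U$ is dissipative if there is a bounded nonautonomous set $\{B_0(t):t\in\mathbb R\}$ (called pullback absorbing) such that for every $E\in\mathcal B(X)$ and $t\in\mathbb R$ there is $\bar\tau=\bar\tau(t,E)\le t$ with $U(t,\tau;E)\subset B_0(t)$ for all $\tau\le\bar\tau$; it is monotonically dissipative if in addition $B_0(s)\subset B_0(t)$ for every $s\le t$. *)

(* Defs.v *)
From mathcomp Require Import all_boot all_order all_algebra.
From mathcomp Require Import all_classical all_reals all_analysis.

Set Implicit Arguments.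
Unset Strict Implicit.
Unset Printing Implicit Defensive.

Import Order.TTheory GRing.Theory Num.Theory.
Import numFieldNormedType.Exports.

Local Open Scope classical_set_scope.
Local Open Scope ring_scope.

Section MetricNotions.
Context {R : realType} {X : metricType R}.

(* The completeness axiom of [completeType], without the distinguished point
   which that structure requires: [X] may be empty. *)
Definition metric_complete : Prop :=
  forall F : set_system X, ProperFilter F -> cauchy F -> exists l : X, F --> l.

Definition metric_bounded (A : set X) : Prop :=
  exists M : R, forall x y, A x -> A y -> mdist x y <= M.

Definition dist_pt (y : X) (B : set X) : \bar R :=
  ereal_inf [set (mdist x y)%:E | x in B].

(* Hausdorff semidistance; not symmetric in its arguments. *)
Definition dist_set (A B : set X) : \bar R :=
  ereal_sup [set dist_pt y B | y in A].

End MetricNotions.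
Arguments metric_complete {R} X.

Section NonautonomousSets.
Context {R : realType} {X : metricType R}.
Implicit Type K : R -> set X.

Definition na_closed K := forall t, closed (K t).

Definition na_compact K := forall t, compact (K t).

Definition na_bounded K := forall t, metric_bounded (K t).

Definition backward_bounded K :=
  forall tau, metric_bounded (\bigcup_(t in [set t | t <= tau]) K t).

End NonautonomousSets.

Section MProcesses.
Context {R : realType} {X : metricType R}.
(* [U t tau x] is meaningful for [tau <= t] only: nothing below depends on the
   values of [U] at other times. *)
Implicit Type U : R -> R -> X -> set X.

Definition mp_image U (t s : R) (A : set X) : set X := \bigcup_(y in A) U t s y.

Record is_mprocess U : Prop := IsMProcess {
  mp_nonempty : forall t tau x, tau <= t -> U t tau x !=set0 ;
  mp_id : forall t x, U t t x = [set x] ;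
  mp_sub : forall t s tau x, tau <= s -> s <= t ->
    U t tau x `<=` mp_image U t s (U s tau x)
}.

Definition pullback_attracting U (K : R -> set X) : Prop :=
  forall (t : R) (B : set X), B !=set0 -> metric_bounded B ->
    dist_set (mp_image U t tau B) (K t) @[tau --> -oo] --> 0%E.

Record is_pullback_attractor U (A : R -> set X) : Prop := IsPullbackAttractor {
  pa_compact : na_compact A ;
  pa_attracting : pullback_attracting U A ;
  pa_minimal : forall C : R -> set X, na_closed C -> pullback_attracting U C ->
    forall t, A t `<=` C t
}.

Definition pullback_asymptotically_compact U : Prop :=
  forall (B : set X) (t : R) (tau : nat -> R) (xi : nat -> X),
    B !=set0 -> metric_bounded B ->
    (forall n, tau n <= t) -> tau n @[n --> \oo] --> -oo ->
    (forall n, mp_image U t (tau n) B (xi n)) ->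
    exists2 phi : nat -> nat, {homo phi : m n / (m < n)%N} &
      exists l : X, xi (phi n) @[n --> \oo] --> l.

Definition pullback_absorbing U (B0 : R -> set X) : Prop :=
  na_bounded B0 /\
  forall (E : set X) (t : R), E !=set0 -> metric_bounded E ->
    exists2 taubar, taubar <= t &
      forall tau, tau <= taubar -> mp_image U t tau E `<=` B0 t.

Definition monotonically_dissipative U : Prop :=
  exists2 B0 : R -> set X, pullback_absorbing U B0 &
    forall s t, s <= t -> B0 s `<=` B0 t.

End MProcesses.

(* Main.v *)
Require Import Defs.
From mathcomp Require Import all_boot all_order all_algebra.
From mathcomp Require Import all_classical all_reals all_analysis.
From mathcomp Require Import lra.

Set Implicit Arguments.
Unset Strict Implicit.
Unset Printing Implicit Defensive.

Import Order.TTheory GRing.Theory Num.Theory.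
Import numFieldNormedType.Exports.

Local Open Scope classical_set_scope.
Local Open Scope ring_scope.

(** The attractor is the pullback omega-limit set of the absorbing family,
    [A t = omega_limit U t (B0 t)].

    Let [U] be pullback asymptotically compact and monotonically dissipative.
    The sets [U(t, tau; B)] with [tau <= s] form the tail of [B] before [s];
    these tails decrease as [s] goes to minus infinity, and the omega-limit set
    is the intersection of their closures. Asymptotic compactness says that a
    sequence picked in ever earlier tails has a convergent subsequence, whose
    limit is then in the omega-limit set ([asymptotically_compact_tail]). This
    has two consequences. First, the omega-limit set of [B] attracts [B]: points
    of the tails staying away from it would accumulate outside of it
    ([omega_limit_attracting]). Second, it is compact: for every [e] some tail
    is covered by finitely many [e]-balls, since otherwise one could pick a
    sequence in earlier and earlier tails whose terms are [e] apart
    ([subseq_finite_cover]), and a closed totally bounded subset of a complete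
    space is compact ([omega_limit_compact]).

    Monotonicity turns this into one attractor for all bounded sets. A bounded
    set started early enough is at time [s] inside [B0 s], hence inside [B0 t],
    and from there it goes on as part of the evolution of [B0 t]; so the
    omega-limit set of any bounded set at [t] lies in that of [B0 t]
    ([omega_limit_absorbing]). Minimality holds because a closed set that
    attracts [B0 t] contains its omega-limit set
    ([omega_limit_sub_closed]), and backward boundedness because [A s] lies in
    the closure of [B0 s], hence of [B0 t], for all [s <= t]. Two attractors are
    closed and attracting, so by minimality each is contained in the other.

    Conversely, let [A] be a backward bounded attractor. The family of
    1-neighbourhoods of the union of the [A s], [s <= t], is bounded, monotone
    in [t] and absorbing. A sequence [xi n] in [U(t, tau n; B)] approaches the
    compact set [A t], so it has a cluster point there
    ([cluster_of_compact]). *)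

(** * Neighbourhoods and compactness in metric spaces *)

Section MetricSpaces.
Context {R : realType} {X : metricType R}.
Implicit Types (x y l : X) (A B K S : set X) (e : R).

Definition enlargement e A : set X := \bigcup_(x in A) ball x e.

Lemma ballE x e y : ball x e y = (mdist x y < e) :> Prop.
Proof. by rewrite ballEmdist. Qed.

Lemma closure_enlargement e A : 0 < e -> closure A `<=` enlargement e A.
Proof.
by move=> e0 x /(_ _ (nbhsx_ballx x e e0))[a [Aa /ball_sym xa]]; exists a.
Qed.

Lemma metric_bounded_sub A B : A `<=` B -> metric_bounded B -> metric_bounded A.
Proof. by move=> AB [M BM]; exists M => x y /AB Bx /AB By; exact: BM. Qed.

Lemma metric_bounded_enlargement e A :
  metric_bounded A -> metric_bounded (enlargement e A).
Proof.
move=> [M AM]; exists (M + e *+ 2) => x y [a Aa ax] [b Ab by_].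
move: ax by_; rewrite !ballE => ax by_.
have := metric_triangle x a y; have := metric_triangle a b y.
have := AM _ _ Aa Ab; rewrite (metric_sym x a) => ? ? ?; lra.
Qed.

Lemma dist_pt_lt y B e : (dist_pt y B < e%:E)%E <-> enlargement e B y.
Proof.
split=> [/ereal_inf_lt[_ [x Bx <-]]|[x Bx]].
  by rewrite lte_fin -ballE => xy; exists x.
rewrite ballE -lte_fin; apply: le_lt_trans; apply: ereal_inf_lbound.
by exists x.
Qed.

Lemma dist_pt_ge0 y B : (0 <= dist_pt y B)%E.
Proof. by apply: le_ereal_inf_tmp => _ [x _ <-]; rewrite lee_fin mdist_ge0. Qed.

(** Restates attraction without extended reals. The sets must eventually be
    nonempty because the semidistance from the empty set is minus infinity,
    which does not tend to 0 although the inclusion holds trivially. *)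
Lemma dist_set_cvg0P {T : Type} (F : set_system T) (S : T -> set X) K :
  Filter F -> (\forall i \near F, S i !=set0) ->
  dist_set (S i) K @[i --> F] --> 0%E <->
  forall e, 0 < e -> \forall i \near F, S i `<=` enlargement e K.
Proof.
move=> FF SF; split=> [S0 e e0|SK].
  have e0E : (0 < e%:E)%E by rewrite lte_fin.
  have Se : \forall i \near F, (dist_set (S i) K < e%:E)%E.
    exact: S0 (open_ereal_lt' e0E).
  apply: filterS Se => i /= Sie y Siy; apply/dist_pt_lt.
  by apply: le_lt_trans Sie; apply: ereal_sup_ubound; exists y.
have bnd e : 0 < e -> \forall i \near F, (0 <= dist_set (S i) K <= e%:E)%E.
  move=> e0; apply: filterS2 SF (SK e e0) => i [y Siy] SiK; apply/andP; split.
    apply: le_trans (dist_pt_ge0 y K) _.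
    by apply: ereal_sup_ubound; exists y.
  by apply: ge_ereal_sup => _ [z Sz <-]; apply/ltW/dist_pt_lt/SiK.
apply/fine_cvgP; split.
  apply: filterS (bnd 1 ltr01) => i /andP[? ?].
  by rewrite fin_numElt (lt_le_trans (ltNyr 0))//= (le_lt_trans _ (ltry 1)).
apply/cvgrPdist_lt => e e0; have e20 : 0 < e / 2 by lra.
apply: filterS (bnd _ e20) => i /=.
case: (dist_set _ _) => [r| |] /=; rewrite ?lee_fin ?leeNy_eq//=.
  by move=> /andP[? ?]; rewrite sub0r normrN ger0_norm//; lra.
by rewrite leye_eq andbF.
Qed.

(** Indices are chosen recursively: the next one exceeds the previous one and
    its term is within [1 / (n + 1)] of [l]. *)
Lemma cluster_subseq (u : nat -> X) l : cluster (u @ \oo) l ->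
  exists2 phi : nat -> nat, {homo phi : m n / (m < n)%N} &
    u (phi n) @[n --> \oo] --> l.
Proof.
move=> ul.
have step (p : nat * nat) : exists n, (p.2 < n)%N /\ ball l p.1.+1%:R^-1 (u n).
  have e0 : 0 < p.1.+1%:R^-1 :> R by rewrite invr_gt0.
  have up : (u @ \oo) (u @` [set n | (p.2 < n)%N]).
    by exists p.2.+1 => // n /= pn; exists n.
  by have [_ [[n pn <-] ln]] := ul _ _ up (nbhsx_ballx l _ e0); exists n.
have [next nextP] := choice step.
pose phi := fix phi n := if n is m.+1 then next (m.+1, phi m) else next (0, 0)%N.
exists phi.
  by apply: homo_ltn => [m n p|n]; [exact: ltn_trans|have [] := nextP (n.+1, phi n)].
have phil n : ball l n.+1%:R^-1 (u (phi n)).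
  by case: n => [|n]; [exact: (nextP (0, 0)%N).2|exact: (nextP (n.+1, phi n)).2].
apply/cvg_ballP => e e0.
near=> n; apply: le_ball (phil n).
by apply: ltW; near: n; exact: (near_infty_natSinv_lt (PosNum e0)).
Unshelve. all: by end_near. Qed.

(** If no point of [K] were a cluster point, each point of [K] would have a ball
    that [u] eventually avoids; by compactness some [d]-neighbourhood of [K]
    would be eventually avoided, against the hypothesis. Near-covering
    compactness, applied to pairs (radius, index), yields that uniform [d]. *)
Lemma cluster_of_compact {T : Type} (F : set_system T) (u : T -> X) K :
  ProperFilter F -> compact K ->
  (forall e, 0 < e -> \forall i \near F, enlargement e K (u i)) ->
  exists2 l, K l & cluster (u @ F) l.
Proof.
move=> FF cK uK; apply: contrapT => noclu.
have /(_ _ (filter_prod 0^'+ F) (fun p x => ~ ball x p.1 (u p.2))) :=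
  (compact_near_coveringP K).1 cK.
case=> [x Kx|[P Q] /= [P0 FQ] PQ].
  have : ~ cluster (u @ F) x by move=> ?; apply: noclu; exists x.
  move=> /existsNP[V /existsNP[W /not_implyP[FV /not_implyP[xW VW]]]].
  have [e /= e0 eW] := (@nbhs_ballP _ _ x W).1 xW.
  exists (ball x (e / 2), [set p | p.1 < e / 2 /\ V (u p.2)]) => /=.
    split; first by apply: nbhsx_ballx; lra.
    exists ([set d | d < e / 2], [set i | V (u i)]) => /=.
      by split => //; apply: nbhs_right_lt; lra.
    by move=> [d i].
  move=> [y [d i]] /= [xy [de Vui]] yui; apply: VW; exists (u i); split => //.
  apply: eW; rewrite (splitr e); apply: ball_triangle xy _.
  by apply: le_ball yui; exact: ltW.
have [d [Pd d0]] : exists d, P d /\ 0 < d.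
  near (0:R)^'+ => d; exists d; split; first by near: d; exact: P0.
  by near: d; exact: nbhs_right_gt.
have [i [Qi [x Kx xui]]] := filter_ex (filterI FQ (uK d d0)).
exact: (PQ (d, i) (conj Pd Qi) x Kx).
Unshelve. all: by end_near. Qed.

(** Otherwise no finite family of [e]-balls covers any [S n], and one can pick
    [u n] in [S n] outside the [e]-balls around the previous terms; such a
    sequence has no convergent subsequence. *)
Lemma subseq_finite_cover (S : nat -> set X) e : 0 < e ->
  (forall u : nat -> X, (forall n, S n (u n)) ->
    exists2 phi : nat -> nat, {homo phi : m n / (m < n)%N} &
      exists l, u (phi n) @[n --> \oo] --> l) ->
  exists n (r : seq X), S n `<=` enlargement e [set` r].
Proof.
move=> e0 Ssub; apply: contrapT => nocov.
have pick (p : seq X * nat) :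
    exists x, S p.2 x /\ forall y, y \in p.1 -> ~ ball y e x.
  apply: contrapT => np; apply: nocov; exists p.2, p.1 => x Sx.
  apply: contrapT => nx; apply: np; exists x; split => // y yp yx.
  by apply: nx; exists y.
have [g gP] := choice pick.
(* [L n] lists the terms of index less than [n]. *)
pose L := fix L n := if n is m.+1 then g (L m, m) :: L m else [::].
pose u n := g (L n, n).
have uL m n : (m < n)%N -> u m \in L n.
  elim: n => // n IH; rewrite ltnS leq_eqVlt => /orP[/eqP ->|/IH mn] /=.
    by rewrite inE eqxx.
  by rewrite inE mn orbT.
have [phi phi_mono [l ul]] := Ssub u (fun n => (gP (L n, n)).1).
have /cvg_ballP/(_ (e / 2))[|N _ Nl] := ul; first by lra.
have lu n : (N <= n)%N -> ball l (e / 2) (u (phi n)) by move=> /Nl.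
apply: ((gP (L (phi N.+1), phi N.+1)).2 (u (phi N))).
  by apply: uL; exact: phi_mono.
rewrite (splitr e); apply: ball_triangle (lu N.+1 (leqnSn N)).
exact/ball_sym/lu.
Qed.

(** An ultrafilter containing [K] contains one ball of each finite cover, so it
    is Cauchy. *)
Lemma compact_of_finite_covers K : metric_complete X -> closed K ->
  (forall e, 0 < e -> exists r : seq X, K `<=` enlargement e [set` r]) ->
  compact K.
Proof.
move=> hX cK covK; rewrite compact_ultra => F FU FK.
have FC : cauchy F.
  apply: cauchy_exP => e e0; have [r Kr] := covK e e0.
  have : F (enlargement e [set` r]) by exact: filterS FK.
  elim: r {Kr} => [|x r IH] Fr.
    exfalso; apply: (@filter_not_empty _ F _).
    by apply: filterS Fr => y [].
  have [Fx|Fx] := in_ultra_setVsetC (ball x e) FU; first by exists x.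
  apply: IH; apply: filterS2 Fr Fx => y [z] /=.
  by rewrite inE => /orP[/eqP -> //|zr zy _]; exists z.
have [l Fl] := hX F _ FC.
exists l; split => //; apply: cK => V /Fl FV.
exact: filter_ex (filterI FK FV).
Qed.

End MetricSpaces.

(** * Pullback omega-limit sets *)

Section OmegaLimits.
Context {R : realType} {X : metricType R}.
Context (U : R -> R -> X -> set X).
Implicit Types (B C : set X) (s t tau : R).

Definition tail t s B : set X :=
  \bigcup_(tau in [set tau | tau <= s]) mp_image U t tau B.

Definition omega_limit t B : set X :=
  \bigcap_(s in [set s | s <= t]) closure (tail t s B).

Lemma tail_mono t s s' B : s' <= s -> tail t s' B `<=` tail t s B.
Proof. by move=> s's x [tau /= taus' Ux]; exists tau => //=; exact: le_trans s's. Qed.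

Lemma tailP t B (P : set X) :
  (\forall tau \near -oo, mp_image U t tau B `<=` P) <->
  exists2 s, s <= t & tail t s B `<=` P.
Proof.
split=> [[M [_ MP]]|[s _ sP]].
  exists (Num.min t (M - 1)); first by rewrite ge_min lexx.
  move=> x [tau /=]; rewrite le_min => /andP[_ tauM]; apply: MP; lra.
exists s; split; first exact: num_real.
by move=> tau taus x Ux; apply: sP; exists tau => //=; exact: ltW.
Qed.

(** Points of the tails are eventually within [e / 2] of [C], so their limits
    are within [e] of [C], for every [e]. *)
Lemma omega_limit_sub_closed t B C : closed C ->
  (forall e, 0 < e ->
    \forall tau \near -oo, mp_image U t tau B `<=` enlargement e C) ->
  omega_limit t B `<=` C.
Proof.
move=> cC CB x xom; apply: cC => V /nbhs_ballP[e /= e0 eV].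
have e20 : 0 < e / 2 by lra.
have /tailP[s st sC] := CB _ e20.
have [y [/sC[c Cc cy] xy]] := xom s st _ (nbhsx_ballx x _ e20).
exists c; split => //; apply: eV; rewrite (splitr e).
by apply: ball_triangle xy _; exact: ball_sym.
Qed.

(** The form in which asymptotic compactness is used: the starting times are
    only known to go to minus infinity, and the limit is located. *)
Lemma asymptotically_compact_tail t B (u : nat -> X) :
  pullback_asymptotically_compact U -> B !=set0 -> metric_bounded B ->
  (forall n, tail t (t - n%:R) B (u n)) ->
  exists2 phi : nat -> nat, {homo phi : m n / (m < n)%N} &
    exists2 l, omega_limit t B l & u (phi n) @[n --> \oo] --> l.
Proof.
move=> hU B0 bB /= tu.
have /choice[tau tauP] n : exists s, s <= t - n%:R /\ mp_image U t s B (u n).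
  by have [s] := tu n; exists s.
have tau_t n : tau n <= t.
  by apply: le_trans (tauP n).1 _; rewrite lerBlDr lerDl ler0n.
have tau_oo : tau n @[n --> \oo] --> -oo.
  apply/cvgrNyPle => A; near=> n; apply: le_trans (tauP n).1 _.
  rewrite lerBlDl -lerBlDr; near: n; exact: nbhs_infty_ger.
have [phi phi_mono [l ul]] := hU B t tau u B0 bB tau_t tau_oo (fun n => (tauP n).2).
exists phi => //; exists l => // s /= st.
have phi_ge n : (n <= phi n)%N.
  by elim: n => // n /leq_ltn_trans; apply; exact: phi_mono.
apply: (@closed_cvg _ _ \oo _ _ (closure (tail t s B)) _ _ l ul).
  exact: closed_closure.
near=> n; apply: subset_closure; apply: tail_mono (tu (phi n)).
rewrite lerBlDl -lerBlDr; apply: (@le_trans _ _ n%:R); last by rewrite ler_nat.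
near: n; exact: nbhs_infty_ger.
Unshelve. all: by end_near. Qed.

(** A sequence in earlier and earlier tails that stays [e] away from the
    omega-limit set would have a subsequence converging into that set. *)
Lemma omega_limit_attracting t B :
  pullback_asymptotically_compact U -> B !=set0 -> metric_bounded B ->
  forall e, 0 < e ->
    \forall tau \near -oo,
      mp_image U t tau B `<=` enlargement e (omega_limit t B).
Proof.
move=> hU B0 bB e e0; apply: contrapT => /tailP natt.
have /choice[u uP] n : exists x, tail t (t - n%:R) B x /\
    ~ enlargement e (omega_limit t B) x.
  apply: contrapT => nx; apply: natt; exists (t - n%:R).
    by rewrite lerBlDr lerDl ler0n.
  by move=> x tx; apply: contrapT => ex; apply: nx; exists x.
have [phi _ [l lom /cvg_ballP/(_ _ e0)[N _ Nl]]] :=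
  asymptotically_compact_tail hU B0 bB (fun n => (uP n).1).
by apply: (uP (phi N)).2; exists l => //; apply: Nl => /=.
Qed.

(** The omega-limit set lies in the closure of every tail, and tails are
    eventually covered by finitely many balls of any given radius. *)
Lemma omega_limit_compact t B : metric_complete X ->
  pullback_asymptotically_compact U -> B !=set0 -> metric_bounded B ->
  compact (omega_limit t B).
Proof.
move=> hX hU B0 bB; apply: compact_of_finite_covers => //.
  by apply: closed_bigI => s _; exact: closed_closure.
move=> e e0; have e20 : 0 < e / 2 by lra.
have [u tu|n [r tr]] := @subseq_finite_cover _ X (fun n => tail t (t - n%:R) B) _ e20.
  have [phi ? [l _ ?]] := asymptotically_compact_tail hU B0 bB tu.
  by exists phi => //; exists l.
exists r => x xom.
have tn : t - n%:R <= t by rewrite lerBlDr lerDl ler0n.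
have [y /tr[c rc cy] yx] := closure_enlargement e20 (xom _ tn).
by exists c => //; rewrite (splitr e); exact: ball_triangle yx.
Qed.

Section Absorbing.
Context (B0 : R -> set X) (hU : is_mprocess U).
Context (B0_absorbing : pullback_absorbing U B0).

(** Some point [x] of the space is needed: over the empty space every family
    is absorbing. *)
Lemma absorbing_nonempty t (x : X) : B0 t !=set0.
Proof.
have bx : metric_bounded [set x].
  by exists 0 => _ _ -> ->; rewrite mdistxx.
have [s st /(_ s (lexx s)) sB0] := B0_absorbing.2 [set x] t (ex_intro _ x erefl) bx.
by have [y Uy] := mp_nonempty hU x st; exists y; apply: sB0; exists x.
Qed.

(** For [s <= t], the evolution of [B] from an early time to [t] passes at time
    [s] through [B0 s], a subset of [B0 t], so it ends in [U(t, s; B0 t)]. Thus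
    every tail of [B0 t] contains a tail of [B]. *)
Lemma omega_limit_absorbing t B : B !=set0 -> metric_bounded B ->
  (forall s, s <= t -> B0 s `<=` B0 t) ->
  omega_limit t B `<=` omega_limit t (B0 t).
Proof.
move=> Bn bB mono x xom s /= st.
have [s' s's absB] := B0_absorbing.2 B s Bn bB.
apply: closureS (xom s' (le_trans s's st)) => y [tau /= taus' [b Bb]].
move=> /(mp_sub hU (le_trans taus' s's) st)[z Uz Uy].
exists s => //=; exists z => //; apply: (mono s st).
by apply: (absB tau taus'); exists b.
Qed.

Lemma omega_limit_sub_closure t B : B !=set0 -> metric_bounded B ->
  omega_limit t B `<=` closure (B0 t).
Proof.
move=> Bn bB x xom; have [s st absB] := B0_absorbing.2 B t Bn bB.
by apply: closureS (xom s st) => y [tau /= taus]; exact: absB.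
Qed.

End Absorbing.

End OmegaLimits.

(** * Pullback attractors *)

Section Attractors.
Context {R : realType} {X : metricType R}.
Context (U : R -> R -> X -> set X) (hU : is_mprocess U).

Lemma pullback_attractingP (K : R -> set X) :
  pullback_attracting U K <-> forall t B, B !=set0 -> metric_bounded B ->
    forall e, 0 < e ->
      \forall tau \near -oo, mp_image U t tau B `<=` enlargement e (K t).
Proof.
have ne t B : B !=set0 -> \forall tau \near -oo, mp_image U t tau B !=set0.
  move=> [b Bb]; exists t; split; first exact: num_real.
  move=> tau /ltW tau_t; have [y Uy] := mp_nonempty hU b tau_t.
  by exists y, b.
by split=> attK t B Bn bB; apply/(dist_set_cvg0P _ _ (ne t B Bn)); exact: attK.
Qed.

Lemma pullback_attractor_unique (A A' : R -> set X) :
  is_pullback_attractor U A -> is_pullback_attractor U A' -> A = A'.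
Proof.
suff sub (K K' : R -> set X) t : is_pullback_attractor U K ->
    is_pullback_attractor U K' -> K t `<=` K' t.
  by move=> hA hA'; apply/funext => t; apply/seteqP; split; exact: sub.
move=> hK [cK' attK' _]; apply: (pa_minimal hK) => // s.
exact: compact_closed (@metric_hausdorff _ X) (cK' s).
Qed.

Lemma omega_limit_attractor (B0 : R -> set X) : metric_complete X ->
  pullback_asymptotically_compact U -> pullback_absorbing U B0 ->
  (forall s t, s <= t -> B0 s `<=` B0 t) ->
  is_pullback_attractor U (fun t => omega_limit U t (B0 t)) /\
  backward_bounded (fun t => omega_limit U t (B0 t)).
Proof.
move=> hX pac absB mono.
split; last first.
  move=> t; apply: metric_bounded_sub (metric_bounded_enlargement 1 (absB.1 t)).
  move=> x [s st xom]; apply: (closure_enlargement ltr01).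
  apply: (closureS (mono s t st)); apply: omega_limit_sub_closure xom => //.
    exact: absorbing_nonempty hU absB _ x.
  exact: absB.1.
split.
  (* In the empty space [B0 t] is empty, so it has to be treated apart. *)
- move=> t; have [[x _]|X0] := pselect ([set: X] !=set0).
    by apply: omega_limit_compact => //; [exact: absorbing_nonempty hU absB _ x|exact: absB.1].
  suff -> : omega_limit U t (B0 t) = set0 by exact: compact0.
  by rewrite -subset0 => x _; apply: X0; exists x.
- apply/pullback_attractingP => t B Bn bB e e0.
  apply: filterS (omega_limit_attracting t pac Bn bB e0) => tau UB.
  apply: subset_trans UB _; apply: bigcup_subset.
  by apply: (omega_limit_absorbing hU absB Bn bB) => s; exact: mono.
- move=> C cC /pullback_attractingP attC t x xom.
  apply: (omega_limit_sub_closed (cC t) _ xom); apply: attC.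
    exact: absorbing_nonempty hU absB _ x.
  exact: absB.1.
Qed.

Lemma attractor_asymptotically_compact (A : R -> set X) :
  na_compact A -> pullback_attracting U A -> pullback_asymptotically_compact U.
Proof.
move=> cA /pullback_attractingP attA B t tau xi Bn bB _ tau_oo xiU.
have [e e0|l _ /cluster_subseq[phi ? ?]] :=
    @cluster_of_compact _ _ _ \oo xi (A t) _ (cA t).
  have near_A : \forall n \near \oo,
      mp_image U t (tau n) B `<=` enlargement e (A t).
    exact: tau_oo (attA t B Bn bB e e0).
  by apply: filterS near_A => n /(_ _ (xiU n)).
by exists phi => //; exists l.
Qed.

Lemma attractor_monotonically_dissipative (A : R -> set X) :
  backward_bounded A -> pullback_attracting U A -> monotonically_dissipative U.
Proof.
move=> bA /pullback_attractingP attA.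
exists (fun t => enlargement 1 (\bigcup_(s in [set s | s <= t]) A s)).
  split=> [t|E t En bE]; first exact: metric_bounded_enlargement.
  have /tailP[s st sA] := attA t E En bE 1 ltr01.
  exists s => // tau taus x Ux.
  have [|a Aa ax] := sA x; first by exists tau.
  by exists a => //; exists t => /=.
move=> s t st; apply: bigcup_subset; apply: bigcup_subset => r /=.
by move=> rs; exact: le_trans st.
Qed.

End Attractors.

Theorem theorem3p5 (R : realType) (X : metricType R) (hX : metric_complete X)
    (U : R -> R -> X -> set X) (hU : is_mprocess U) :
  (pullback_asymptotically_compact U /\ monotonically_dissipative U) <->
  (exists! A : R -> set X, is_pullback_attractor U A /\ backward_bounded A).
Proof.
split=> [[pac [B0 absB mono]]|[A [[hA bA] _]]].
  have [hA bA] := omega_limit_attractor hU hX pac absB mono.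
  exists (fun t => omega_limit U t (B0 t)); split=> // A' [hA' _].
  exact: pullback_attractor_unique hA hA'.
split; first exact: attractor_asymptotically_compact (pa_compact hA) (pa_attracting hA).
exact: attractor_monotonically_dissipative bA (pa_attracting hA).
Qed.
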